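(* Let $(\mathcal{A},\varphi)$ be a non-commutative probability space, $\theta$ a state on $\mathcal{A}$, and $\big((\mathcal{A}_\ell^{(\iota)},\mathcal{A}_r^{(\iota)})\big)_{\iota\in\mathcal{I}}$ a family of pairs of faces in $\mathcal{A}$. Then the family is conditionally bi-free with respect to $(\theta,\varphi)$ if and only if the following holds: whenever $n\ge1$, $\chi:\{1,\dots,n\}\to\{\ell,r\}$, $\epsilon:\{1,\dots,n\}\to\mathcal{I}$, $\mathcal{J}$ is the set of maximal $\epsilon$-monochromatic $\chi$-intervals, and $z_1,\dots,z_n\in\mathcal{A}$ satisfy $z_i\in\mathcal{A}^{(\epsilon(i))}_{\chi(i)}$ and $\varphi(z_J)=0$ for every $J\in\mathcal{J}$, then $$\varphi(z_1\cdots z_n)=0\qquad\text{and}\qquad \theta(z_1\cdots z_n)=\prod_{J\in\mathcal{J}}\theta(z_J).$$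
   Context: A non-commutative probability space is a pair $(\mathcal{A},\varphi)$ with $\mathcal{A}$ a unital $*$-algebra and $\varphi$ a state; a pair of faces is a pair of unital subalgebras $(\mathcal{A}_\ell,\mathcal{A}_r)$. Notation: for $\chi:\{1,\dots,n\}\to\{\ell,r\}$ write $\chi^{-1}(\ell)=\{i_1<\dots<i_p\}$, $\chi^{-1}(r)=\{i_{p+1}>\dots>i_n\}$, $s_\chi(k)=i_k$, and $i\prec_\chi j$ iff $s_\chi^{-1}(i)<s_\chi^{-1}(j)$. A $\chi$-interval is an interval for $\prec_\chi$. A set is $\epsilon$-monochromatic if $\epsilon$ is constant on it. For $B=\{b_1<\dots<b_k\}$, $z_B:=z_{b_1}\cdots z_{b_k}$. $BNC(\chi)$ is the set of partitions $\pi$ of $\{1,\dots,n\}$ such that $s_\chi^{-1}\cdot\pi$ is a non-crossing partition. The bi-free cumulants $\kappa_\chi:\mathcal{A}^n\to\mathbb{C}$ (with respect to $\varphi$) are the multilinear functionals determined by $\varphi(z_1\cdots z_n)=\sum_{\pi\in BNC(\chi)}\prod_{B\in\pi}\kappa_{\chi|_B}((z_1,\dots,z_n)|_B)$. For $\pi\in BNC(\chi)$, a block $B\in\pi$ is inner if there is another block $C\in\pi$ and $j,k\in C$ with $j\prec_\chi i\prec_\chi k$ for every $i\in B$; otherwise $B$ is outer. The conditional cumulants $\mathcal{K}_\chi:\mathcal{A}^n\to\mathbb{C}$ with respect to $(\theta,\varphi)$ are the multilinear functionals determined by $$\theta(z_1\cdots z_n)=\sum_{\pi\in BNC(\chi)}\Big(\prod_{V\in\pi,\,V\text{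 inner}}\kappa_{\chi|_V}((z_1,\dots,z_n)|_V)\Big)\Big(\prod_{V\in\pi,\,V\text{ outer}}\mathcal{K}_{\chi|_V}((z_1,\dots,z_n)|_V)\Big).$$ The family is conditionally bi-free with respect to $(\theta,\varphi)$ if it is bi-free with respect to $\varphi$ (i.e. all mixed bi-free cumulants $\kappa_\chi(z_1,\dots,z_n)$ with $z_i\in\mathcal{A}^{(\epsilon(i))}_{\chi(i)}$, $\epsilon$ non-constant, vanish) and all mixed conditional cumulants $\mathcal{K}_\chi(z_1,\dots,z_n)$ with $z_i\in\mathcal{A}^{(\epsilon(i))}_{\chi(i)}$, $\epsilon$ non-constant, vanish. *)

(* Defs.v *)
From HB Require Import structures.
From mathcomp Require Import all_boot all_order all_algebra.
From Stdlib Require Import ClassicalEpsilon.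
Set Implicit Arguments. Unset Strict Implicit. Unset Printing Implicit Defensive.
Import Order.TTheory GRing.Theory Num.Theory Num.Def.
Local Open Scope ring_scope.

Definition asbool (P : Prop) : bool :=
  if excluded_middle_informative P then true else false.

Section Defs.
Variable C : numClosedFieldType.
Variable A : algType C.

Definition is_star (star : A -> A) : Prop :=
  [/\ forall a, star (star a) = a,
      forall a b, star (a + b) = star a + star b,
      forall (c : C) a, star (c *: a) = c^* *: star a
    & forall a b, star (a * b) = star b * star a].

Definition is_state (star : A -> A) (phi : A -> C) : Prop :=
  [/\ forall a b, phi (a + b) = phi a + phi b,
      forall (c : C) a, phi (c *: a) = c * phi a,
      phi 1 = 1
    & forall a, 0 <= phi (star a * a)].

Definition unital_subalg (S : A -> Prop) : Prop :=
  [/\ S 1,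
      forall a b, S a -> S b -> S (a + b),
      forall (c : C) a, S a -> S (c *: a)
    & forall a b, S a -> S b -> S (a * b)].
End Defs.

(* ---------- combinatorics; side convention: true = l (left), false = r (right) ---------- *)

(* i <_chi j  iff  s_chi^{-1}(i) < s_chi^{-1}(j), where s_chi lists the left
   indices increasingly, then the right indices decreasingly *)
Definition chi_prec n (chi : 'I_n -> bool) (i j : 'I_n) : bool :=
  match chi i, chi j with
  | true, true => (i < j)%N
  | true, false => true
  | false, true => false
  | false, false => (j < i)%N
  end.

Definition crossing n (chi : 'I_n -> bool) (B D : {set 'I_n}) : bool :=
  [exists a in B, exists b in D, exists c in B, exists d in D,
     [&& chi_prec chi a b, chi_prec chi b c & chi_prec chi c d]].

Definition BNC n (chi : 'I_n -> bool) (P : {set {set 'I_n}}) : bool :=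
  partition P [set: 'I_n] &&
  [forall B in P, forall D in P, (B != D) ==> ~~ crossing chi B D].

Definition restr n T (f : 'I_n -> T) (B : {set 'I_n}) : seq T := [seq f i | i <- enum B].
Definition args n T (f : 'I_n -> T) : seq T := restr f [set: 'I_n].

Definition inner n (chi : 'I_n -> bool) (P : {set {set 'I_n}}) (V : {set 'I_n}) : bool :=
  [exists D in P, (D != V) &&
     [exists j in D, exists k in D, [forall i in V, chi_prec chi j i && chi_prec chi i k]]].

Section Cumulants.
Variable C : numClosedFieldType.
Variable A : algType C.

(* a family of functionals kappa_chi, indexed by chi (as a list of sides),
   applied to the list of arguments *)
Definition cumulant_family := seq bool -> seq A -> C.

Definition bf_cumulants (phi : A -> C) (kappa : cumulant_family) : Prop :=
  forall n (chi : 'I_n -> bool) (z : 'I_n -> A), (0 < n)%N ->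
    phi (\prod_(i < n) z i) =
    \sum_(P : {set {set 'I_n}} | BNC chi P)
       \prod_(B in P) kappa (restr chi B) (restr z B).

Definition cond_cumulants (theta : A -> C) (kappa K : cumulant_family) : Prop :=
  forall n (chi : 'I_n -> bool) (z : 'I_n -> A), (0 < n)%N ->
    theta (\prod_(i < n) z i) =
    \sum_(P : {set {set 'I_n}} | BNC chi P)
       ((\prod_(V in P | inner chi P V) kappa (restr chi V) (restr z V)) *
        (\prod_(V in P | ~~ inner chi P V) K (restr chi V) (restr z V))).

Variable I : Type.
Variables Al Ar : I -> A -> Prop.

Definition face (i : I) (s : bool) : A -> Prop := if s then Al i else Ar i.

Definition mixed_vanish (f : cumulant_family) : Prop :=
  forall n (chi : 'I_n -> bool) (eps : 'I_n -> I) (z : 'I_n -> A),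
    (forall i, face (eps i) (chi i) (z i)) ->
    (exists i j, eps i <> eps j) ->
    f (args chi) (args z) = 0.

Definition cond_bifree (phi theta : A -> C) : Prop :=
  forall kappa K : cumulant_family,
    bf_cumulants phi kappa -> cond_cumulants theta kappa K ->
    mixed_vanish kappa /\ mixed_vanish K.

Definition chi_interval n (chi : 'I_n -> bool) (J : {set 'I_n}) : Prop :=
  forall i j k, i \in J -> k \in J -> chi_prec chi i j -> chi_prec chi j k -> j \in J.

Definition monochromatic n (eps : 'I_n -> I) (J : {set 'I_n}) : Prop :=
  forall i j, i \in J -> j \in J -> eps i = eps j.

Definition max_mono_interval n (chi : 'I_n -> bool) (eps : 'I_n -> I) (J : {set 'I_n}) : Prop :=
  [/\ chi_interval chi J, monochromatic eps J &
      forall J', chi_interval chi J' -> monochromatic eps J' -> J \subset J' -> J' = J].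

Definition zprod n (z : 'I_n -> A) (J : {set 'I_n}) : A := \prod_(i <- enum J) z i.

Definition vanishing_characterization (phi theta : A -> C) : Prop :=
  forall n (chi : 'I_n -> bool) (eps : 'I_n -> I) (z : 'I_n -> A),
    (0 < n)%N ->
    (forall i, face (eps i) (chi i) (z i)) ->
    (forall J, max_mono_interval chi eps J -> phi (zprod z J) = 0) ->
    phi (\prod_(i < n) z i) = 0 /\
    theta (\prod_(i < n) z i) =
      \prod_(J : {set 'I_n} | asbool (max_mono_interval chi eps J)) theta (zprod z J).
End Cumulants.

(* Main.v *)
Require Import Defs.
From HB Require Import structures.
From mathcomp Require Import all_boot all_order all_algebra.
From Stdlib Require Import FunctionalExtensionality ClassicalEpsilon.
Set Implicit Arguments. Unset Strict Implicit. Unset Printing Implicit Defensive.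
Import Order.TTheory GRing.Theory Num.Theory.
Local Open Scope ring_scope.

(** Bi-free cumulants are the conditional cumulants with [theta = phi] and
    [K = kappa], so every statement is proved once, for conditional cumulants.

    Suppose the mixed cumulants vanish and [phi (z_J) = 0] for every maximal
    monochromatic interval [J]. A non-crossing partition with monochromatic
    blocks either has each [J] as a union of blocks, or has some [J] that is a
    union of blocks and lies between two elements of another block. In the
    second case all blocks inside [J] are inner, and summing over them
    produces the factor [phi (z_J) = 0]. The partitions of the first kind sum
    to the product of the [theta (z_J)].

    Conversely, cumulants of order at least two do not change when scalars are
    added to the arguments. Since [phi (\prod_(j in J) (z_j + t))] is a monic
    polynomial in [t], some translate of the arguments satisfies
    [phi (z_J) = 0] for all [J]. By induction on the order, comparing the
    moment formula with the prescribed value leaves only the mixed cumulant of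
    full order, which is therefore zero. *)

(** * Non-crossing partitions in a finite strict total order *)

Section NonCrossing.
Variables (T : finType) (lt : rel T).
Hypothesis lt_irr : irreflexive lt.
Hypothesis lt_trans : transitive lt.
Hypothesis lt_total : forall x y, x != y -> lt x y || lt y x.
Implicit Types (S J V B D : {set T}) (P Q : {set {set T}}).

Definition cross B D : bool :=
  [exists a in B, exists b in D, exists c in B, exists d in D,
     [&& lt a b, lt b c & lt c d]].

(** The ground set is an arbitrary subset of [T], so that an interval and its complement can be
    treated without changing the type. *)
Definition nc S : {set {set {set T}}} :=
  [set P | partition P S &&
    [forall B in P, forall D in P, (B != D) ==> ~~ cross B D]].

(* Agrees with [inner] on the blocks of [P], but also applies to unions of
   blocks. *)
Definition covered P V : bool :=
  [exists D in P, exists j in D, exists k in D,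
     [forall i in V, lt j i && lt i k]].

(** When [P] partitions a set containing [J], this says that [J] is a union of blocks. *)
Definition saturated P J : bool := [forall B in P, (B \subset J) || [disjoint B & J]].

Definition is_interval J : bool :=
  [forall x in J, forall z in J, forall y, lt x y && lt y z ==> (y \in J)].

Lemma lt_asym x y : lt x y -> lt y x = false.
Proof. by move=> xy; apply/negP => /(lt_trans xy); rewrite lt_irr. Qed.

Lemma partition_blocksP P S : reflect
  [/\ forall B, B \in P -> B \subset S,
      set0 \notin P,
      forall x, x \in S -> exists2 B, B \in P & x \in B
    & forall B D x, B \in P -> D \in P -> x \in B -> x \in D -> B = D]
  (partition P S).
Proof.
apply: (iffP and3P) => [[/eqP cP tP P0] | [sub P0 cP dis]].
  split=> // [B BP | x | B D x BP DP xB xD].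
  - by rewrite -cP; apply: bigcup_sup.
  - by rewrite -cP => /bigcupP [B BP xB]; exists B.
  - by rewrite -(def_pblock tP BP xB) -(def_pblock tP DP xD).
split=> //.
  apply/eqP/setP => x; apply/bigcupP/idP => [[B BP xB] | /cP [B BP xB]].
    exact: (subsetP (sub _ BP)).
  by exists B.
apply/trivIsetP => B D BP DP; apply: contraR => /pred0Pn [x /andP [xB xD]].
by apply/eqP; apply: (dis B D x).
Qed.

Lemma crossP B D : reflect
  (exists a b c d, [/\ a \in B, b \in D, c \in B & d \in D] /\
     [/\ lt a b, lt b c & lt c d]) (cross B D).
Proof.
apply: (iffP existsP) => [[a /andP [aB /existsP [b /andP [bD /existsP [c
   /andP [cB /existsP [d /andP [dD /and3P H]]]]]]]] | [a [b [c [d [[aB bD cB dD] H]]]]]].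
  by exists a, b, c, d.
exists a; rewrite aB /=; apply/existsP; exists b; rewrite bD /=.
apply/existsP; exists c; rewrite cB /=; apply/existsP; exists d; rewrite dD /=.
exact/and3P.
Qed.

Lemma ncP P S : reflect
  (partition P S /\ forall B D, B \in P -> D \in P -> cross B D -> B = D)
  (P \in nc S).
Proof.
rewrite inE; apply: (iffP andP) => [[pP /forall_inP H] | [pP H]]; split=> //.
  move=> B D BP DP cBD; apply/eqP; apply: contraLR cBD => BD.
  by move/forall_inP: (H B BP) => /(_ D DP); rewrite BD.
apply/forall_inP => B BP; apply/forall_inP => D DP; apply/implyP.
by apply: contraNN => /(H _ _ BP DP) ->.
Qed.

Lemma coveredP P V : reflect
  (exists D j k, [/\ D \in P, j \in D, k \in D
     & forall i, i \in V -> lt j i /\ lt i k]) (covered P V).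
Proof.
apply: (iffP existsP) => [[D /andP [DP /existsP [j /andP [jD /existsP [k
   /andP [kD /forall_inP H]]]]]] | [D [j [k [DP jD kD H]]]]].
  by exists D, j, k; split=> // i /H /andP.
exists D; rewrite DP; apply/existsP; exists j; rewrite jD.
apply/existsP; exists k; rewrite kD.
by apply/forall_inP => i /H [-> ->].
Qed.

Lemma saturatedP P J : reflect
  (forall B x, B \in P -> x \in B -> x \in J -> B \subset J) (saturated P J).
Proof.
apply: (iffP forall_inP) => [H B x BP xB xJ | H B BP].
  case/orP: (H _ BP) => // /pred0P /(_ x) /=.
  by rewrite xB xJ.
case: (boolP [disjoint B & J]) => [|/pred0Pn [x /andP [xB xJ]]].
  by rewrite orbT.
by rewrite (H B x).
Qed.

Lemma is_intervalP J : reflect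
  (forall x y z, x \in J -> z \in J -> lt x y -> lt y z -> y \in J) (is_interval J).
Proof.
apply: (iffP forall_inP) => [H x y z xJ zJ xy yz | H x xJ].
  by move/forall_inP: (H _ xJ) => /(_ z zJ) /forallP /(_ y); rewrite xy yz.
apply/forall_inP => z zJ; apply/forallP => y; apply/implyP => /andP [xy yz].
exact: (H x y z).
Qed.

Lemma ltNge x y : x != y -> lt x y = ~~ lt y x.
Proof.
move=> xy; case: (boolP (lt y x)) => [/lt_asym // | nyx].
by move: (lt_total xy); rewrite (negPf nyx) orbF.
Qed.

Lemma interval_lt J x y z : is_interval J -> x \in J -> y \in J -> z \notin J ->
  lt z x = lt z y.
Proof.
move=> /is_intervalP ivJ; wlog suff H : x y / x \in J -> y \in J -> z \notin J -> lt z x -> lt z y.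
  by move=> xJ yJ zJ; apply/idP/idP; apply: H.
move=> xJ yJ zJ zx; rewrite ltNge; last by apply: contraNneq zJ => ->.
by apply: contraNN zJ => yz; apply: (ivJ y z x).
Qed.

Lemma interval_gt J x y z : is_interval J -> x \in J -> y \in J -> z \notin J ->
  lt x z = lt y z.
Proof.
move=> ivJ xJ yJ zJ.
have nz w : w \in J -> w != z by move=> wJ; apply: contraNneq zJ => <-.
by rewrite ltNge ?nz // [RHS]ltNge ?nz // (interval_lt ivJ xJ yJ zJ).
Qed.

Lemma nc_split J S P : is_interval J -> [disjoint J & S] ->
  P \in nc (J :|: S) -> saturated P J ->
  [set B in P | B \subset J] \in nc J /\
  [set B in P | ~~ (B \subset J)] \in nc S.
Proof.
move=> ivJ dJS /ncP [/partition_blocksP [sub P0 cP dis] ncPP] /saturatedP saturatedP.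
split; apply/ncP; split.
- apply/partition_blocksP; split.
  + by move=> B; rewrite inE => /andP [].
  + by rewrite inE (negPf P0).
  + move=> x xJ; have /cP [B BP xB] : x \in J :|: S by rewrite inE xJ.
    by exists B => //; rewrite inE BP (saturatedP B x).
  + by move=> B D x; rewrite !inE => /andP [BP _] /andP [DP _]; apply: dis.
- by move=> B D; rewrite !inE => /andP [BP _] /andP [DP _]; apply: ncPP.
- apply/partition_blocksP; split.
  + move=> B; rewrite inE => /andP [BP nBJ]; apply/subsetP => x xB.
    move/subsetP: (sub _ BP) => /(_ x xB); rewrite inE => /orP [xJ|//].
    by rewrite (saturatedP B x) in nBJ.
  + by rewrite inE (negPf P0).
  + move=> x xS; have /cP [B BP xB] : x \in J :|: S by rewrite inE xS orbT.
    exists B => //; rewrite inE BP; apply/negP => /subsetP /(_ x xB) xJ.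
    by move/pred0P: dJS => /(_ x) /=; rewrite xJ xS.
  + by move=> B D x; rewrite !inE => /andP [BP _] /andP [DP _]; apply: dis.
- by move=> B D; rewrite !inE => /andP [BP _] /andP [DP _]; apply: ncPP.
Qed.

(** A crossing puts a point of each block strictly between two points of the other. If one block
    lies in the interval [J], a point of the other would have to lie in [J] as well. *)
Lemma nc_join J S P1 P2 : is_interval J -> [disjoint J & S] ->
  P1 \in nc J -> P2 \in nc S -> P1 :|: P2 \in nc (J :|: S) /\ saturated (P1 :|: P2) J.
Proof.
move=> ivJ dJS /ncP [/partition_blocksP [sub1 P01 c1 dis1] nc1].
move=> /ncP [/partition_blocksP [sub2 P02 c2 dis2] nc2].
have nJ x : x \in S -> x \notin J.
  by move=> xS; apply/negP => xJ; move/pred0P: dJS => /(_ x) /=; rewrite xJ xS.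
have nP B D x : B \in P1 -> D \in P2 -> x \in B -> x \in D -> False.
  move=> /sub1 /subsetP sB /sub2 /subsetP sD /sB xJ /sD /nJ.
  by rewrite xJ.
split.
  apply/ncP; split.
    apply/partition_blocksP; split.
    + move=> B; rewrite inE => /orP [/sub1|/sub2] sB.
        exact: subset_trans sB (subsetUl _ _).
      exact: subset_trans sB (subsetUr _ _).
    + by rewrite inE negb_or P01 P02.
    + move=> x; rewrite inE => /orP [/c1|/c2] [B BP xB]; exists B => //;
      by rewrite inE BP ?orbT.
    + move=> B D x; rewrite !inE => /orP [BP|BP] /orP [DP|DP].
      * exact: dis1.
      * by move=> xB xD; case: (nP B D x).
      * by move=> xB xD; case: (nP D B x).
      * exact: dis2.
  move=> B D; rewrite !inE => /orP [BP|BP] /orP [DP|DP].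
  - exact: nc1.
  - case/crossP => a [b [c [d [[aB bD cB dD] [ab bc cd]]]]].
    move/subsetP: (sub1 _ BP) => sB; move/subsetP: (sub2 _ DP) => sD.
    have := nJ _ (sD _ bD); have /is_intervalP H := ivJ.
    by rewrite (H a b c) ?sB.
  - case/crossP => a [b [c [d [[aB bD cB dD] [ab bc cd]]]]].
    move/subsetP: (sub2 _ BP) => sB; move/subsetP: (sub1 _ DP) => sD.
    have := nJ _ (sB _ cB); have /is_intervalP H := ivJ.
    by rewrite (H b c d) ?sD.
  - exact: nc2.
apply/saturatedP => B x; rewrite inE => /orP [/sub1 //|/sub2 /subsetP sB] /sB /nJ.
by move=> /negPf ->.
Qed.

(** * Weighted sums over non-crossing partitions and their factorization along intervals *)

Section Weights.
Variable R : comNzRingType.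
Implicit Types k K : {set T} -> R.

(** Separating the blocks inside [J] from the rest is a bijection onto pairs of partitions, with
    union as inverse. *)
Lemma big_nc_split J S (F : {set {set T}} -> R) : is_interval J -> [disjoint J & S] ->
  \sum_(P in nc (J :|: S) | saturated P J) F P =
  \sum_(P2 in nc S) \sum_(P1 in nc J) F (P1 :|: P2).
Proof.
move=> ivJ dJS; rewrite pair_big /=.
rewrite (reindex_onto (fun p : {set {set T}} * {set {set T}} => p.2 :|: p.1)
  (fun P => ([set B in P | ~~ (B \subset J)], [set B in P | B \subset J]))) /=; last first.
  by move=> P _; apply/setP => B; rewrite !inE -andb_orr orbN andbT.
apply: eq_bigl => -[P2 P1] /=; apply/andP/andP => [[/andP [ncP saturatedP]] | [nc2 nc1]].
  case: (nc_split ivJ dJS ncP saturatedP) => nc1 nc2 /eqP [e2 e1].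
  by rewrite e1 e2 in nc1 nc2.
case: (nc_join ivJ dJS nc1 nc2) => -> ->; split=> //.
case/ncP: nc1 => /partition_blocksP [sub1 _ _ _] _.
case/ncP: nc2 => /partition_blocksP [sub2 P02 _ _] _.
have n2 B : B \in P2 -> ~~ (B \subset J).
  move=> BP; apply/negP => BJ; case: (set_0Vmem B) => [B0|[x xB]].
    by rewrite -B0 BP in P02.
  move/pred0P: dJS => /(_ x) /=.
  by rewrite (subsetP BJ) ?(subsetP (sub2 _ BP)).
apply/eqP; congr pair; apply/setP => B; rewrite !inE.
  case: (boolP (B \in P2)) => [/n2 -> | _]; first by rewrite orbT.
  by rewrite orbF; case: (boolP (B \in P1)) => //= /sub1 ->.
case: (boolP (B \in P1)) => [/sub1 -> // | _] /=.
by case: (boolP (B \in P2)) => //= /n2 /negPf ->.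
Qed.

(** The summand of the moment formula for conditional cumulants: [k] weighs inner blocks and [K]
    outer ones. Taking [K] equal to [k] gives the bi-free formula. *)
Definition weight k K P : R := \prod_(V in P) (if covered P V then k V else K V).
Definition moment k K S : R := \sum_(P in nc S) weight k K P.

Lemma coveredU P1 P2 V : covered (P1 :|: P2) V = covered P1 V || covered P2 V.
Proof.
apply/coveredP/orP => [[D [j [k [DP jD kD H]]]] | [] /coveredP [D [j [k [DP jD kD H]]]]].
- move: DP; rewrite inE => /orP [] DP; [left|right]; apply/coveredP; by exists D, j, k.
- by exists D, j, k; rewrite inE DP.
- by exists D, j, k; rewrite inE DP orbT.
Qed.

Lemma disjoint_absurd J S x : [disjoint J & S] -> x \in J -> x \in S -> False.
Proof. by move=> /disjointFr H /H ->. Qed.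

(** The points of the blocks of [P] lie outside [J], each on one side of the whole interval, so they
    cannot tell a part of [J] from [J]. *)
Lemma covered_sub J S P V : is_interval J -> [disjoint J & S] -> P \in nc S ->
  V \subset J -> V != set0 -> covered P V = covered P J.
Proof.
move=> ivJ dJS /ncP [/partition_blocksP [sub _ _ _] _] VJ /set0Pn [v vV].
have nJ B x : B \in P -> x \in B -> x \notin J.
  by move=> /sub /subsetP sB xB; apply/negP => /(disjoint_absurd dJS); apply; apply: sB.
have vJ := subsetP VJ _ vV.
apply/coveredP/coveredP => -[D [j [k [DP jD kD H]]]]; exists D, j, k; split=> // i iV.
  have [jv vk] := H _ vV.
  by rewrite (interval_lt ivJ iV vJ) ?(interval_gt ivJ iV vJ) ?(nJ D).
exact/H/(subsetP VJ).
Qed.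

Lemma covered_out J S P V : is_interval J -> [disjoint J & S] -> P \in nc J ->
  V \subset S -> V != set0 -> covered P V = false.
Proof.
move=> ivJ dJS /ncP [/partition_blocksP [sub _ _ _] _] VS /set0Pn [v vV].
apply/coveredP => -[D [j [k [DP jD kD /(_ _ vV) [jv vk]]]]].
apply: (disjoint_absurd dJS _ (subsetP VS _ vV)).
by move/is_intervalP: ivJ => /(_ j v k); apply=> //; apply: (subsetP (sub _ DP)).
Qed.

Lemma nc_sub P S B : P \in nc S -> B \in P -> B \subset S.
Proof. by case/ncP => /partition_blocksP [sub _ _ _] _; apply: sub. Qed.

Lemma nc_neq0 P S B : P \in nc S -> B \in P -> B != set0.
Proof. by case/ncP => /partition_blocksP [_ P0 _ _] _ BP; apply: contraNneq P0 => <-. Qed.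

(** If [P2] covers [J], every block inside [J] becomes inner and weighs [k]; otherwise only [P1]
    decides. Blocks of [P2] are never covered by blocks inside [J]. *)
Lemma weightU k K J S P1 P2 : is_interval J -> [disjoint J & S] -> P1 \in nc J -> P2 \in nc S ->
  weight k K (P1 :|: P2) = weight k (if covered P2 J then k else K) P1 * weight k K P2.
Proof.
move=> ivJ dJS nc1 nc2.
have dP : [disjoint P1 & P2].
  rewrite disjoint_subset; apply/subsetP => B B1; rewrite inE; apply/negP => B2.
  have /set0Pn [x xB] := nc_neq0 nc1 B1.
  by apply: (disjoint_absurd dJS (subsetP (nc_sub nc1 B1) _ xB) (subsetP (nc_sub nc2 B2) _ xB)).
rewrite /weight (eq_bigl [predU P1 & P2]) => [|B]; last by rewrite !inE.
rewrite bigU //=.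
congr (_ * _); apply: eq_bigr => V VP; rewrite coveredU.
  rewrite (covered_sub ivJ dJS nc2) ?(nc_sub nc1) ?(nc_neq0 nc1) //.
  by case: ifP => /=; case: (covered P1 V) => //=; case: (covered P2 J).
by rewrite (covered_out ivJ dJS nc1) ?(nc_sub nc2) ?(nc_neq0 nc2).
Qed.

Lemma nc_set0 : nc set0 = [set set0].
Proof.
apply/setP => P; rewrite in_set1; apply/ncP/eqP => [[/partition_blocksP [sub P0 _ _] _] | ->].
  apply/setP => B; rewrite inE; apply/negP => BP.
  by move: (sub _ BP) P0; rewrite subset0 => /eqP <-; rewrite BP.
split=> [|B D]; last by rewrite inE.
by apply/partition_blocksP; split=> [B||x|B D x]; rewrite ?inE.
Qed.

Lemma nc_set1 x : nc [set x] = [set [set [set x]]].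
Proof.
apply/setP => P; rewrite in_set1; apply/ncP/eqP => [[/partition_blocksP [sub P0 cP _] _] | ->].
  have eqB B : B \in P -> B = [set x].
    move=> BP; have := sub _ BP; rewrite subset1 => /orP [/eqP //|/eqP B0].
    by rewrite -B0 BP in P0.
  apply/setP => B; rewrite inE; apply/idP/eqP => [/eqB // | ->].
  by have [|B' BP _] := cP x; rewrite ?set11 // -(eqB _ BP).
split=> [|B D]; last by rewrite !inE => /eqP -> /eqP ->.
apply/partition_blocksP; split=> [B||y|B D y]; rewrite ?inE.
- by move/eqP->.
- by apply/eqP => /setP /(_ x); rewrite !inE eqxx.
- by move/eqP ->; exists [set x]; rewrite ?inE.
- by move=> /eqP -> /eqP ->.
Qed.

(** Since [p] does not see the part inside [J], the sum over that part factors out as a moment of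
    [J]. For covered [J] this is [moment k k J], the factor that vanishes in the centred case. *)
Lemma big_nc_interval k K J S (p : pred {set {set T}}) :
  is_interval J -> [disjoint J & S] ->
  (forall P1 P2, P1 \in nc J -> P2 \in nc S -> p (P1 :|: P2) = p P2) ->
  \sum_(P in nc (J :|: S) | saturated P J && p P) weight k K P =
  \sum_(P in nc S | p P) moment k (if covered P J then k else K) J * weight k K P.
Proof.
move=> ivJ dJS pP; under eq_bigl do rewrite andbA.
rewrite big_mkcondr big_nc_split // [RHS]big_mkcondr.
apply: eq_bigr => P2 nc2; rewrite /moment big_distrl /=; case: ifP => p2.
  by apply: eq_bigr => P1 nc1; rewrite pP // p2 (weightU _ _ ivJ dJS).
by apply: big1 => P1 nc1; rewrite pP // p2.
Qed.

Lemma saturatedU P1 P2 J : saturated (P1 :|: P2) J = saturated P1 J && saturated P2 J.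
Proof.
apply/forall_inP/andP => [H | [/forall_inP H1 /forall_inP H2] B].
  by split; apply/forall_inP => B BP; apply: H; rewrite inE BP ?orbT.
by rewrite inE => /orP [/H1|/H2].
Qed.

Lemma saturated_disjoint J J' P : [disjoint J & J'] -> P \in nc J -> saturated P J'.
Proof.
move=> dJ ncP; apply/saturatedP => B x BP xB xJ'; case: (disjoint_absurd dJ _ xJ').
exact: (subsetP (nc_sub ncP BP)).
Qed.

(** Induction on the number of intervals, splitting off one at a time. It is never covered by the
    others: a block around it lies in a single interval of [F], which would then meet it. *)
Lemma moment_isolated k K (F : {set {set T}}) :
  trivIset F -> set0 \notin F -> (forall J, J \in F -> is_interval J) ->
  \sum_(P in nc (cover F) | [forall J in F, saturated P J]) weight k K P =
  \prod_(J in F) moment k K J.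
Proof.
move: {2}#|F| (erefl #|F|) => m; elim: m F => [|m IH] F.
  move/eqP; rewrite cards_eq0 => /eqP -> _ _ _.
  rewrite big_set0 /cover big_set0 nc_set0 big_mkcondr big_set1 /weight big_set0.
  by case: ifP => // /forall_inP []; move=> J; rewrite inE.
move=> cF tF F0 ivF.
have /card_gt0P [J JF] : (0 < #|F|)%N by rewrite cF.
set F' := F :\ J.
have FE : F = J |: F' by rewrite setD1K.
have dF' J' : J' \in F' -> [disjoint J & J'].
  rewrite !inE eq_sym => /andP [JJ' J'F].
  by move/trivIsetP: tF; apply.
have cF' : #|F'| = m by apply/eqP; rewrite -eqSS -cF (cardsD1 J F) JF.
have tF' : trivIset F' by apply: trivIsetS tF; apply: subsetDl.
have F'0 : set0 \notin F' by rewrite inE negb_and F0 orbT.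
have ivF' J' : J' \in F' -> is_interval J' by rewrite inE => /andP [_ /ivF].
have dJ : [disjoint J & cover F'].
  by apply: bigcup_disjoint => J' /dF'.
have cover_E : cover F = J :|: cover F' by rewrite FE /cover big_setU1 //= !inE eqxx.
rewrite [RHS](big_setD1 J) //= -/F' -(IH F') // big_distrr /= cover_E.
rewrite (eq_bigl (fun P => (P \in nc (J :|: cover F')) &&
  (saturated P J && [forall J' in F', saturated P J']))); last first.
  move=> P; congr (_ && _); apply/forall_inP/andP => [H | [H1 /forall_inP H2] J'].
    split; first exact: H.
    by apply/forall_inP => J'; rewrite inE => /andP [_ /H].
  by rewrite FE !inE => /orP [/eqP -> // | J'F]; apply: H2; rewrite !inE.
rewrite big_nc_interval ?ivF //; last first.
  move=> P1 P2 nc1 nc2; apply: eq_forallb => J'; case: (boolP (J' \in F')) => //= J'F.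
  by rewrite saturatedU (saturated_disjoint _ nc1) ?dF'.
apply: eq_bigr => P /andP [ncP /forall_inP sP]; case: ifP => // /coveredP [D [j [k' [DP jD kD H]]]].
have /set0Pn [x xJ] : J != set0 by apply: contraNneq F0 => <-.
have /bigcupP [J' J'F jJ'] := subsetP (nc_sub ncP DP) _ jD.
have /saturatedP /(_ D j DP jD jJ') /subsetP DJ' := sP _ J'F.
have [jx xk] := H x xJ.
case: (disjoint_absurd (dF' _ J'F) xJ).
by have /is_intervalP H' := ivF' _ J'F; apply: (H' j x k'); rewrite ?DJ'.
Qed.

End Weights.

(** * Maximal monochromatic intervals *)

Section Colouring.
Variables (X : eqType) (col : T -> X).

Definition mono V : bool := [forall x in V, forall y in V, col x == col y].
Definition max_mono : {set {set T}} := [set J | maxset (fun V => is_interval V && mono V) J].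

Lemma monoP V : reflect (forall x y, x \in V -> y \in V -> col x = col y) (mono V).
Proof.
apply: (iffP forall_inP) => [H x y xV yV | H x xV].
  by apply/eqP; move/forall_inP: (H _ xV); apply.
by apply/forall_inP => y yV; rewrite (H x y).
Qed.

Lemma is_interval1 x : is_interval [set x].
Proof.
apply/is_intervalP => a b c; rewrite !inE => /eqP -> /eqP -> xb /(lt_trans xb).
by rewrite lt_irr.
Qed.

(** A point between [a] and [c] is compared with the common point [x]: it lies between [x] and one
    of [a], [c], hence in the interval holding that end. *)
Lemma is_intervalU J J' x : is_interval J -> is_interval J' ->
  x \in J -> x \in J' -> is_interval (J :|: J').
Proof.
move=> /is_intervalP iJ /is_intervalP iJ' xJ xJ'; apply/is_intervalP => a b c.
have [-> * | nbx] := eqVneq b x; first by rewrite inE xJ.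
rewrite !inE => /orP [] aJ /orP [] cJ ab bc; case/orP: (lt_total nbx) => [bx|xb];
  apply/orP.
all: try by left; apply: (iJ a b c).
all: try by right; apply: (iJ' a b c).
all: try by left; apply: (iJ a b x).
all: try by left; apply: (iJ x b c).
all: try by right; apply: (iJ' a b x).
all: by right; apply: (iJ' x b c).
Qed.

Lemma max_monoP J : reflect
  [/\ is_interval J, mono J & forall J', is_interval J' -> mono J' -> J \subset J' -> J' = J]
  (J \in max_mono).
Proof.
rewrite inE; apply: (iffP maxsetP) => [[/andP [iJ mJ] H] | [iJ mJ H]].
  by split=> // J' i m; apply: H; rewrite i.
by split=> [|J' /andP [i m]]; [rewrite iJ | apply: H].
Qed.

Lemma max_mono_sup V : is_interval V -> mono V -> exists2 J, J \in max_mono & V \subset J.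
Proof.
move=> i m; have [|J mJ VJ] := @maxset_exists _ (fun V => is_interval V && mono V) V.
  by rewrite i m.
by exists J; rewrite // inE.
Qed.

Lemma max_mono_eq J J' x : J \in max_mono -> J' \in max_mono ->
  x \in J -> x \in J' -> J = J'.
Proof.
move=> /max_monoP [iJ mJ HJ] /max_monoP [iJ' mJ' HJ'] xJ xJ'.
have iU := is_intervalU iJ iJ' xJ xJ'.
have mU : mono (J :|: J').
  have cx y : y \in J :|: J' -> col y = col x.
    by rewrite inE => /orP [yJ|yJ]; [move/monoP: mJ | move/monoP: mJ']; apply.
  by apply/monoP => a b /cx -> /cx ->.
by rewrite -(HJ _ iU mU (subsetUl _ _)); apply: HJ' (subsetUr _ _).
Qed.

Lemma mono1 x : mono [set x].
Proof. by apply/monoP => a b; rewrite !inE => /eqP -> /eqP ->. Qed.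

Lemma max_mono_cover x : exists2 J, J \in max_mono & x \in J.
Proof.
have [J mJ] := max_mono_sup (is_interval1 x) (mono1 x).
by rewrite sub1set; exists J.
Qed.

(** On an empty type [set0] would itself be maximal, and a partition has no empty block. *)
Lemma max_mono_partition : (0 < #|T|)%N -> partition max_mono [set: T].
Proof.
move=> /card_gt0P [x0 _]; apply/partition_blocksP; split=> //.
- apply/negP => /max_monoP [_ _ H].
  have /setP /(_ x0) := H _ (is_interval1 x0) (mono1 x0) (sub0set _).
  by rewrite !inE eqxx.
- by move=> x _; apply: max_mono_cover.
- by move=> B D x; apply: max_mono_eq.
Qed.

Lemma max_mono_between J a b : J \in max_mono -> a \in J -> b \notin J ->
  lt a b -> col a = col b -> exists c, [/\ lt a c, lt c b & col c != col a].
Proof.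
move=> mJ aJ bJ ab cab.
case: (boolP [exists c, [&& lt a c, lt c b & col c != col a]]) => [/existsP [c /and3P]|].
  by exists c.
move=> /existsPn H; case/negP: bJ.
(* If every point between [a] and [b] had the colour of [a], the closed segment [V] would be a
   monochromatic interval, hence lie in [J] together with [b]. *)
pose V := [set x | ((x == a) || lt a x) && ((x == b) || lt x b)].
have cV x : x \in V -> col x = col a.
  rewrite inE => /andP [/orP [/eqP -> //|ax] /orP [/eqP -> //|xb]].
  by move: (H x); rewrite ax xb /= negbK => /eqP.
have [||J' mJ' /subsetP VJ'] := @max_mono_sup V.
- apply/is_intervalP => x y z; rewrite !inE => /andP [ax _] /andP [_ zb] xy yz.
  have -> : lt a y by case/orP: ax => [/eqP <- //|ax]; apply: lt_trans ax xy.
  have -> : lt y b by case/orP: zb => [/eqP <- //|zb]; apply: lt_trans yz zb.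
  by rewrite !orbT.
- by apply/monoP => x y /cV -> /cV ->.
rewrite (max_mono_eq mJ mJ' aJ) ?VJ' // inE ?eqxx ?ab ?orbT //.
Qed.

(* Descent: the interval of a point strictly between [a] and [b] and of another
   colour is either a union of blocks, or gives a pair of points closer to each other. *)
Lemma exists_isolated P V J a b :
  P \in nc [set: T] -> (forall B, B \in P -> mono B) ->
  V \in P -> a \in V -> b \in V -> J \in max_mono -> a \in J -> b \notin J ->
  exists J', [/\ J' \in max_mono, saturated P J' & covered P J'].
Proof.
move=> /ncP [/partition_blocksP [_ _ _ dis] ncP] mP.
(* The measure counts the points strictly between [a] and [b] in either order, so that the two may
   be exchanged. *)
have [m] := ubnP #|[set x | (lt a x && lt x b) || (lt b x && lt x a)]|.
elim: m V J a b => // m IH V J a b.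
wlog ab : V J a b / lt a b.
  move=> W lem VP aV bV mJ aJ bJ.
  have nab : a != b by apply: contraNneq bJ => <-.
  case/orP: (lt_total nab) => [ab|ba]; first exact: (W V J a b).
  have [J' mJ' bJ'] := max_mono_cover b.
  apply: (W V J' b a) => //.
    by apply: leq_trans lem; rewrite ltnS; apply/subset_leq_card/subsetP => x; rewrite !inE orbC.
  by apply: contraNN bJ => aJ'; rewrite (max_mono_eq mJ mJ' aJ aJ').
move=> lem VP aV bV mJ aJ bJ.
have [|c [ac cb cca]] := max_mono_between mJ aJ bJ ab.
  by move/monoP: (mP _ VP); apply.
have [J' mJ' cJ'] := max_mono_cover c.
have /max_monoP [ivJ' /monoP mJ'c _] := mJ'.
have aJ' : a \notin J'.
  by apply: contra cca => aJ'; rewrite (mJ'c c a).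
have bJ' : b \notin J'.
  apply: contra cca => bJ'; rewrite (mJ'c c b) //.
  by move/monoP: (mP _ VP) => /(_ b a) ->.
have btw x : x \in J' -> lt a x /\ lt x b.
  by move=> xJ'; rewrite (interval_lt ivJ' xJ' cJ' aJ') (interval_gt ivJ' xJ' cJ' bJ').
case: (boolP (saturated P J')) => [sJ' | /saturatedP].
  by exists J'; split=> //; apply/coveredP; exists V, a, b.
case: (boolP [exists D in P, exists d in D, exists e in D,
  (d \in J') && (e \notin J')]); last first.
  move=> /exists_inPn H []; move=> D d DP dD dJ'; apply/subsetP => e eD.
  have /exists_inPn /(_ d dD) /exists_inPn /(_ e eD) := H _ DP.
  by rewrite dJ' negbK.
move=> /exists_inP [D DP /exists_inP [d dD /exists_inP [e eD /andP [dJ' eJ']]]] _.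
have [ad db] := btw _ dJ'.
have DV : D != V.
  apply: contraNneq cca => DV; rewrite (mJ'c c d) //.
  by move/monoP: (mP _ VP) => /(_ d a) ->; rewrite // -DV.
(* [D] has the point [d] between [a] and [b]; as it does not cross [V], its point [e] is there
   too. *)
have ae : lt a e.
  rewrite ltNge; last by apply: contraNneq DV => ae; rewrite (dis D V e) // -ae.
  apply: contra DV => ea; apply/eqP/ncP => //.
  by apply/crossP; exists e, a, d, b.
have eb : lt e b.
  rewrite ltNge; last by apply: contraNneq DV => eb; rewrite (dis D V e) // eb.
  apply: contra DV => be; apply/eqP/esym/ncP => //.
  by apply/crossP; exists a, d, b, e.
(* The segment between [d] and [e] lies within the one between [a] and [b], and [d] itself is no
   longer counted. *)
apply: (IH D J' d e) => //; rewrite -ltnS; apply: leq_trans lem; rewrite ltnS.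
apply: proper_card; apply/properP; split.
  apply/subsetP => x; rewrite !inE => /orP [] /andP [h1 h2]; apply/orP; left.
    by rewrite (lt_trans ad h1) (lt_trans h2 eb).
  by rewrite (lt_trans ae h1) (lt_trans h2 db).
exists d; first by rewrite inE ad db.
by rewrite inE lt_irr /= andbF.
Qed.


(** A block of [P] around [J] would force [J] to meet [J'], hence to equal it; an end of the
    covering pair would then lie strictly after itself. *)
Lemma max_mono_not_covered P J J' : J' \in max_mono -> P \in nc J' ->
  J \in max_mono -> covered P J = false.
Proof.
move=> mJ' ncP mJ; apply/coveredP => -[D [j [k [DP jD kD H]]]].
have sD := subsetP (nc_sub ncP DP).
have [x xJ] : exists x, x \in J.
  apply/set0Pn; apply: contraTneq mJ => ->; apply/negP => /max_monoP [_ _ m0].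
  have /setP /(_ j) := m0 _ (is_interval1 j) (mono1 j) (sub0set _).
  by rewrite !inE eqxx.
have [jx xk] := H _ xJ; have /max_monoP [/is_intervalP iJ' _ _] := mJ'.
have xJ' : x \in J' by apply: (iJ' j x k); rewrite ?sD.
have [] := H j; first by rewrite (max_mono_eq mJ mJ' xJ xJ') sD.
by rewrite lt_irr.
Qed.

(** Partitions with a saturated and covered interval cancel in groups; among those with
    monochromatic blocks, the remaining ones saturate every interval, and [moment_isolated] sums
    them. *)
Lemma moment_max_mono (R : comNzRingType) (k K : {set T} -> R) : (0 < #|T|)%N ->
  (forall V, ~~ mono V -> k V = 0) -> (forall V, ~~ mono V -> K V = 0) ->
  (forall J, J \in max_mono -> moment k k J = 0) ->
  moment k K [set: T] = \prod_(J in max_mono) moment k K J.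
Proof.
move=> T0 k0 K0 kJ.
have pM := max_mono_partition T0.
pose c P := [set J in max_mono | saturated P J && covered P J].
have cP P J : [pick J in c P] == Some J -> J \in c P.
  by case: pickP => // x xc /eqP [<-].
(* Choosing one element of [c P] puts each partition in exactly one group, so nothing is counted
   twice. The group [None] gives the product, every group [Some J] gives zero. *)
rewrite [LHS](partition_big (fun P => [pick J in c P]) xpredT) //=.
rewrite (bigD1 None) //= [X in _ + X]big1 ?addr0 => [|]; last first.
  move=> [J|//] _; case: (boolP (J \in max_mono)) => [mJ|nJ]; last first.
    by apply: big1 => P /andP [_ /cP]; rewrite inE (negPf nJ).
  have /max_monoP [ivJ _ _] := mJ.
  have dJ : [disjoint J & ~: J] by rewrite -setI_eq0 setICr.
  rewrite -(setUCr J) (eq_bigl (fun P => (P \in nc (J :|: ~: J)) &&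
    (saturated P J && ([pick J in c P] == Some J)))); last first.
    move=> P; congr (_ && _); case: (boolP (_ == _)) => [/cP|_]; last by rewrite andbF.
    by rewrite inE => /and3P [_ -> _].
  rewrite big_nc_interval // => [|P1 P2 nc1 nc2].
    apply: big1 => P /andP [_ /cP]; rewrite inE => /and3P [_ _ ->].
    by rewrite kJ // mul0r.
  (* The choice must not depend on how [J] is partitioned, so that the sum over [P1] is
     unrestricted. *)
  suff -> : c (P1 :|: P2) = c P2 by [].
  apply/setP => J'; rewrite [LHS]inE [RHS]inE; case: (boolP (J' \in max_mono)) => //= mJ'.
  rewrite saturatedU coveredU (max_mono_not_covered mJ nc1 mJ') /=; congr (_ && _).
  rewrite (_ : saturated P1 J' = true) //.
  have [<-|nJJ'] := eqVneq J J'.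
    by apply/saturatedP => B x /(nc_sub nc1).
  apply: saturated_disjoint nc1; case/and3P: pM => _ /trivIsetP tM _.
  exact: tM.
case/and3P: pM => /eqP coverM tM M0.
have ivM J' : J' \in max_mono -> is_interval J' by case/max_monoP.
rewrite -(moment_isolated k K tM M0 ivM).
rewrite coverM !big_mkcondr /=; apply: eq_bigr => P ncP.
case: (boolP [forall V in P, mono V]) => [/forall_inP mP|]; last first.
  move=> /forall_inPn [V VP nmV].
  have -> : weight k K P = 0 by rewrite /weight (bigD1 V) //= k0 // K0 // if_same mul0r.
  by rewrite !if_same.
(* If some interval is not saturated, a block leaves it, and [exists_isolated] yields an element of
   [c P]. If all are saturated, none can be covered. *)
have -> // : ([pick J in c P] == None) = [forall J in max_mono, saturated P J].
apply/idP/forall_inP => [|sP].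
  case: pickP => // c0 _ J mJ; apply/saturatedP => B a BP aB aJ; apply/subsetP => b bB.
  apply/negPn/negP => bJ.
  have [J' [mJ' sJ' cJ']] := exists_isolated ncP mP BP aB bB mJ aJ bJ.
  by have := c0 J'; rewrite inE mJ' sJ' cJ'.
case: pickP => // J; rewrite inE => /and3P [mJ sJ /coveredP [D [j [k' [DP jD kD H]]]]].
have [J' mJ' jJ'] := max_mono_cover j.
have /saturatedP /(_ D j DP jD jJ') /subsetP sD := sP _ mJ'.
have [x xJ] : exists x, x \in J by apply/set0Pn; apply: contraNneq M0 => <-.
have [jx xk] := H _ xJ; have /max_monoP [/is_intervalP iJ' _ _] := mJ'.
have xJ' : x \in J' by apply: (iJ' j x k'); rewrite ?sD.
have [] := H j; first by rewrite (max_mono_eq mJ mJ' xJ xJ') sD.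
by rewrite lt_irr.
Qed.

End Colouring.

(** * Change of a moment when the weights change on the full set and on one singleton *)

Section Shift.
Variable R : comNzRingType.
Implicit Types k K : {set T} -> R.

Lemma nc_setT_block P : P \in nc [set: T] -> [set: T] \in P -> P = [set [set: T]].
Proof.
move=> ncT TP; have /ncP [/partition_blocksP [_ _ _ dis] _] := ncT.
apply/setP => B; rewrite inE; apply/idP/eqP => [BP | -> //].
have /set0Pn [x xB] := nc_neq0 ncT BP.
by apply: (dis _ _ x); rewrite ?inE.
Qed.

Lemma nc_setT : (0 < #|T|)%N -> [set [set: T]] \in nc [set: T].
Proof.
move=> /card_gt0P [x0 _]; apply/ncP; split; last by move=> B D; rewrite !inE => /eqP -> /eqP ->.
apply/partition_blocksP; split=> [B|||B D x]; rewrite ?inE //.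
- by apply/eqP => /setP /(_ x0); rewrite !inE.
- by move=> x _; exists [set: T]; rewrite ?inE.
- by move=> /eqP -> /eqP ->.
Qed.

Lemma covered_block P V : V \in P -> covered P V = [exists D in P, (D != V) &&
  [exists j in D, exists k in D, [forall i in V, lt j i && lt i k]]].
Proof.
move=> VP; apply: eq_existsb => D; case: (D \in P) => //=.
have [->|//] := eqVneq D V; apply/existsP => -[j /andP [jV /existsP [k /andP [kV /forall_inP]]]].
by move=> /(_ j jV); rewrite lt_irr.
Qed.

Lemma weight_set1 k K V : weight k K [set V] = K V.
Proof.
rewrite /weight big_set1 covered_block ?set11 //; case: existsP => // -[D].
by rewrite inE => /andP [/eqP ->]; rewrite eqxx.
Qed.

Lemma eq_weight k K k' K' P : (forall V, V \in P -> k V = k' V /\ K V = K' V) ->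
  weight k K P = weight k' K' P.
Proof. by move=> H; apply: eq_bigr => V /H [-> ->]. Qed.

Lemma eq_moment k K k' K' S : (forall V, V \subset S -> k V = k' V /\ K V = K' V) ->
  moment k K S = moment k' K' S.
Proof.
move=> H; apply: eq_bigr => P ncP; apply: eq_weight => V VP; apply: H.
exact: nc_sub ncP VP.
Qed.

(** The full set is a block of the one-block partition only, where it is outer. *)
Lemma moment_setT_sub k K k' K' : (0 < #|T|)%N ->
  (forall V, V != setT -> k' V = k V) -> (forall V, V != setT -> K' V = K V) ->
  moment k' K' [set: T] - moment k K [set: T] = K' [set: T] - K [set: T].
Proof.
move=> T0 Hk HK; rewrite /moment (bigD1 [set setT]) ?nc_setT //=.
rewrite [X in _ - X](bigD1 [set setT]) ?nc_setT //= !weight_set1.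
have e : \sum_(P in nc [set: T] | P != [set setT]) weight k' K' P =
         \sum_(P in nc [set: T] | P != [set setT]) weight k K P.
  apply: eq_bigr => P /andP [ncT nP]; apply: eq_weight => V VP.
  have nV : V != setT.
    by apply: contraNneq nP => VT; apply/eqP/nc_setT_block; rewrite // -VT.
  by rewrite Hk ?HK.
by rewrite e opprD addrACA subrr addr0.
Qed.

(** This models adding the scalar [t] to the argument at [x]. Besides the one-block partition only
    those with the block [[set x]] change; inner or outer, that block gains [t], and removing it
    leaves a partition of the complement. *)
Lemma moment_shift x t k K k' K' : (1 < #|T|)%N ->
  (forall V, V != setT -> V != [set x] -> k' V = k V) ->
  (forall V, V != setT -> V != [set x] -> K' V = K V) ->
  k' [set x] = k [set x] + t -> K' [set x] = K [set x] + t ->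
  moment k' K' [set: T] - moment k K [set: T] =
  K' [set: T] - K [set: T] + t * moment k K (~: [set x]).
Proof.
move=> T1 Hk HK kx Kx.
have nxT : [set x] != [set: T].
  by apply: contraTneq T1 => xT; rewrite -cardsT -xT cards1.
have dx : [disjoint [set x] & ~: [set x]] by rewrite -setI_eq0 setICr.
have momx (g G : {set T} -> R) P : moment g (if covered P [set x] then g else G) [set x] =
    if covered P [set x] then g [set x] else G [set x].
  by rewrite /moment nc_set1 big_set1 weight_set1; case: ifP.
(* [k1] and [K1] keep the change at the singleton but undo the one at the full set, so the two
   effects are computed separately. *)
pose k1 V := if V == setT then k setT else k' V.
pose K1 V := if V == setT then K setT else K' V.
have k1E V : V != [set x] -> k1 V = k V /\ K1 V = K V.
  by move=> Vx; rewrite /k1 /K1; case: eqVneq => [-> //|VT]; rewrite Hk ?HK.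
have -> : K' setT - K setT = moment k' K' setT - moment k1 K1 setT.
  have -> : K setT = K1 setT by rewrite /K1 eqxx.
  rewrite -(@moment_setT_sub k1 K1 k' K') ?(ltnW T1) // => V VT; by rewrite /k1 /K1 (negPf VT).
(* For a partition of the whole type, [saturated P [set x]] means that [[set x]] is a block. *)
have split (g G : {set T} -> R) : moment g G [set: T] =
    \sum_(P in nc (~: [set x])) (if covered P [set x] then g [set x] else G [set x]) * weight g G P
    + \sum_(P in nc [set: T] | ~~ saturated P [set x]) weight g G P.
  rewrite {1}/moment (bigID (fun P => saturated P [set x])) /=; congr (_ + _).
  rewrite -(setUCr [set x]) (eq_bigl (fun P => (P \in nc ([set x] :|: ~: [set x])) &&
    (saturated P [set x] && xpredT P))) => [|P]; last by rewrite andbT.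
  rewrite (big_nc_interval _ _ (is_interval1 x) dx) //; apply: eq_big => [P|P _].
    by rewrite andbT.
  by rewrite momx.
suff <- : moment k1 K1 setT - moment k K setT = t * moment k K (~: [set x]).
  by rewrite addrA subrK.
have k1x : k1 [set x] = k [set x] + t by rewrite /k1 (negPf nxT).
have K1x : K1 [set x] = K [set x] + t by rewrite /K1 (negPf nxT).
have k1E' P : P \in nc (~: [set x]) -> weight k1 K1 P = weight k K P.
  move=> ncT; apply: eq_weight => V VP; apply: k1E; apply: contraTneq (nc_sub ncT VP) => ->.
  by rewrite sub1set !inE eqxx.
rewrite !split opprD addrACA [X in _ + X](_ : _ = 0) ?addr0; last first.
  apply/eqP; rewrite subr_eq0; apply/eqP; apply: eq_bigr => P /andP [ncT nsP].
  apply: eq_weight => V VP; apply: k1E; apply: contraNneq nsP => Vx.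
  apply/saturatedP => B y BP yB; rewrite inE => /eqP yx.
  have /ncP [/partition_blocksP [_ _ _ dis] _] := ncT.
  by rewrite (dis _ _ y BP VP) // Vx // yx set11.
rewrite -sumrB /moment big_distrr; apply: eq_bigr => P ncT /=.
rewrite k1E' // -mulrBl k1x K1x; congr (_ * _).
by case: ifP => _; rewrite addrAC subrr add0r.
Qed.
End Shift.
End NonCrossing.

(** * Invariance of moments under order embeddings *)

Section Transport.
Variables (T' T : finType) (lt' : rel T') (lt : rel T) (h : T' -> T).
Hypothesis h_inj : injective h.
Hypothesis h_lt : forall i j, lt (h i) (h j) = lt' i j.

Let img (P : {set {set T'}}) : {set {set T}} := [set h @: B | B : {set T'} in P].

Lemma covered_imset P (V : {set T'}) : covered lt (img P) (h @: V) = covered lt' P V.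
Proof.
apply/coveredP/coveredP => [[_ [_ [_ [/imsetP [D DP ->] /imsetP [j jD ->] /imsetP [k kD ->] H]]]]
  | [D [j [k [DP jD kD H]]]]].
  exists D, j, k; split=> // i iV; rewrite -!h_lt; apply: H; exact: imset_f.
exists (h @: D), (h j), (h k); split; rewrite ?imset_f //.
by move=> _ /imsetP [i iV ->]; rewrite !h_lt; apply: H.
Qed.

Lemma cross_imset (B D : {set T'}) : cross lt (h @: B) (h @: D) = cross lt' B D.
Proof.
apply/crossP/crossP => [[_ [_ [_ [_ [[/imsetP [a aB ->] /imsetP [b bB ->]
   /imsetP [c cB ->] /imsetP [d dB ->]] H]]]]] | [a [b [c [d [[aB bD cB dD] H]]]]]].
  by exists a, b, c, d; rewrite -!h_lt.
by exists (h a), (h b), (h c), (h d); rewrite !h_lt !imset_f.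
Qed.

Lemma nc_imset P : (img P \in nc lt (h @: setT)) = (P \in nc lt' setT).
Proof.
have hI := imset_inj h_inj.
have imgP (B : {set T'}) : (h @: B \in img P) = (B \in P) by rewrite mem_imset.
apply/ncP/ncP => -[/partition_blocksP [sub P0 cP dis] H]; split.
- apply/partition_blocksP; split=> //.
  + by rewrite -imgP imset0.
  + move=> x _; have [|_ /imsetP [B BP ->] hx] := cP (h x); first exact: imset_f.
    by exists B; rewrite // -(mem_imset _ _ h_inj).
  + by move=> B D x BP DP xB xD; apply: hI; apply: (dis _ _ (h x)); rewrite ?imset_f.
- by move=> B D BP DP; rewrite -cross_imset => c; apply/hI/H; rewrite ?imgP.
- apply/partition_blocksP; split=> //.
  + by move=> _ /imsetP [B BP ->]; apply/imsetS/subsetT.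
  + by rewrite -(imset0 h) imgP.
  + by move=> _ /imsetP [x _ ->]; have [//|B BP xB] := cP x; exists (h @: B); rewrite ?imset_f.
  + move=> _ _ _ /imsetP [B BP ->] /imsetP [D DP ->] /imsetP [x xB ->].
    by rewrite mem_imset // => xD; rewrite (dis B D x).
- by move=> _ _ /imsetP [B BP ->] /imsetP [D DP ->]; rewrite cross_imset => /H ->.
Qed.

Lemma moment_imset (R : comNzRingType) (k K : {set T} -> R) :
  moment lt k K (h @: setT) = moment lt' (fun V => k (h @: V)) (fun V => K (h @: V)) setT.
Proof.
have hI := imset_inj h_inj.
have preK (B : {set T'}) : h @^-1: (h @: B) = B.
  by apply/setP => x; rewrite inE mem_imset.
rewrite /moment (reindex_onto img (fun P => [set h @^-1: B | B : {set T} in P])) /=.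
  apply: eq_big => [P|P /andP [ncP _]].
    rewrite nc_imset (_ : _ == P = true) ?andbT // /img -imset_comp.
    by apply/eqP; rewrite -[RHS]imset_id; apply: eq_imset => B /=; rewrite preK.
  rewrite /weight big_imset /=; last by move=> B D _ _; apply: hI.
  by apply: eq_bigr => V VP; rewrite covered_imset.
move=> P ncT; rewrite /img -imset_comp -[RHS]imset_id; apply: eq_in_imset => B BP /=.
apply/setP => x; apply/imsetP/idP => [[y] | xB]; first by rewrite inE => hy ->.
have /imsetP [y _ xy] := subsetP (nc_sub ncT BP) _ xB.
by exists y; rewrite // inE -xy.
Qed.
End Transport.

(** * The order [chi_prec] and its restriction to subsets of indices *)

Lemma enum_ord_sorted n (B : {set 'I_n}) : sorted (relpre val ltn) (enum B).
Proof.
rewrite /enum_mem; apply: sorted_filter; first by move=> x y z; apply: ltn_trans.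
by rewrite -sorted_map -enumT val_enum_ord iota_ltn_sorted.
Qed.

Section ChiOrder.
Variables (n : nat) (chi : 'I_n -> bool).

Lemma chi_irr : irreflexive (chi_prec chi).
Proof. by move=> i; rewrite /chi_prec; case: (chi i); rewrite ltnn. Qed.

Lemma chi_trans : transitive (chi_prec chi).
Proof.
move=> j i k; rewrite /chi_prec; case: (chi i) (chi j) (chi k) => [] [] [] //.
  exact: ltn_trans.
by move=> ji kj; apply: ltn_trans kj ji.
Qed.

Lemma chi_total i j : i != j -> chi_prec chi i j || chi_prec chi j i.
Proof.
by rewrite /chi_prec -(inj_eq val_inj) neq_ltn; case: (chi i) (chi j) => [] []; rewrite // orbC.
Qed.

Lemma enum_val_lt (S : {set 'I_n}) (i j : 'I_#|S|) :
  (enum_val i < enum_val j)%N = (i < j)%N.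
Proof.
have H (a b : 'I_#|S|) : (a < b)%N -> (enum_val a < enum_val b)%N.
  move=> ab; rewrite !(enum_val_nth (enum_default a)).
  apply: (sorted_ltn_nth _ _ (enum_ord_sorted S)) => //.
  - by move=> x y z; apply: ltn_trans.
  - by rewrite inE -cardE.
  - by rewrite inE -cardE.
apply/idP/idP => [|/H //]; case: (ltngtP i j) => // [/H ji|/val_inj ->].
  by move=> /(ltn_trans ji); rewrite ltnn.
by rewrite ltnn.
Qed.

Lemma imset_enum_val (S : {set 'I_n}) : (@enum_val _ S) @: setT = S.
Proof.
apply/setP => x; apply/imsetP/idP => [[i _ ->]|xS]; first exact: enum_valP.
by exists (enum_rank_in xS x) => //; rewrite enum_rankK_in.
Qed.

Lemma chi_prec_enum_val (S : {set 'I_n}) (i j : 'I_#|S|) :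
  chi_prec chi (enum_val i) (enum_val j) = chi_prec (chi \o enum_val) i j.
Proof. by rewrite /chi_prec /= !enum_val_lt. Qed.

(** Both sides read [f] along strictly increasing lists with the same elements, and such lists are
    equal. *)
Lemma restr_enum_val T (f : 'I_n -> T) (S : {set 'I_n}) (B : {set 'I_#|S|}) :
  restr f (enum_val @: B) = restr (f \o enum_val) B.
Proof.
rewrite /restr; transitivity (map f (map enum_val (enum B))); last by rewrite -map_comp.
congr map.
have tr : transitive (relpre (val : 'I_n -> nat) ltn) by move=> x y z; apply: ltn_trans.
apply: (irr_sorted_eq tr).
- by move=> x /=; rewrite ltnn.
- exact: enum_ord_sorted.
- rewrite sorted_map.
  rewrite (@eq_sorted _ _ (relpre val ltn)) ?enum_ord_sorted // => i j /=.
  exact: enum_val_lt.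
- move=> x; rewrite mem_enum; apply/imsetP/mapP => -[y yB ->]; exists y => //.
    by rewrite mem_enum.
  by rewrite mem_enum in yB.
Qed.
End ChiOrder.

(** * Moment formulas on subsets, and translation invariance of cumulants *)

Section Moments.
Variables (C : numClosedFieldType) (A : algType C).
Implicit Types (phi theta : A -> C) (kappa K f : cumulant_family A).

Definition on_blocks f n (chi : 'I_n -> bool) (z : 'I_n -> A) (V : {set 'I_n}) : C :=
  f (restr chi V) (restr z V).

Lemma cond_cumulantsP theta kappa K : cond_cumulants theta kappa K <->
  forall n (chi : 'I_n -> bool) (z : 'I_n -> A), (0 < n)%N ->
    theta (\prod_(i < n) z i) =
    moment (chi_prec chi) (on_blocks kappa chi z) (on_blocks K chi z) setT.
Proof.
have E n (chi : 'I_n -> bool) (z : 'I_n -> A) :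
    moment (chi_prec chi) (on_blocks kappa chi z) (on_blocks K chi z) setT =
    \sum_(P : {set {set 'I_n}} | BNC chi P)
       ((\prod_(V in P | inner chi P V) kappa (restr chi V) (restr z V)) *
        (\prod_(V in P | ~~ inner chi P V) K (restr chi V) (restr z V))).
  rewrite /moment; apply: eq_big => [P|P _]; first by rewrite inE.
  rewrite /weight (bigID (inner chi P)) /=; congr (_ * _).
    by apply: eq_bigr => V /andP [VP iV]; rewrite (covered_block (chi_irr chi) VP) ifT.
  by apply: eq_bigr => V /andP [VP iV]; rewrite (covered_block (chi_irr chi) VP) ifN.
by split=> H n chi z n0; rewrite (H n chi z n0) E.
Qed.

Lemma bf_cumulantsP phi kappa : bf_cumulants phi kappa <-> cond_cumulants phi kappa kappa.
Proof.
suff E n (chi : 'I_n -> bool) (z : 'I_n -> A) :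
    \sum_(P : {set {set 'I_n}} | BNC chi P)
       ((\prod_(V in P | inner chi P V) kappa (restr chi V) (restr z V)) *
        (\prod_(V in P | ~~ inner chi P V) kappa (restr chi V) (restr z V))) =
    \sum_(P : {set {set 'I_n}} | BNC chi P)
       \prod_(B in P) kappa (restr chi B) (restr z B).
  by split=> H n chi z n0; rewrite (H n chi z n0) E.
by apply: eq_bigr => P _; rewrite [RHS](bigID (inner chi P)).
Qed.

Lemma zprodE n (z : 'I_n -> A) S : zprod z S = \prod_(i in S) z i.
Proof. by rewrite /zprod /enum_mem big_filter unlock. Qed.

Lemma on_blocks_enum_val f n (chi : 'I_n -> bool) (z : 'I_n -> A) (S : {set 'I_n}) :
  on_blocks f chi z S = f (args (chi \o @enum_val _ S)) (args (z \o @enum_val _ S)).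
Proof. by rewrite /on_blocks -{1 2}(imset_enum_val S) !restr_enum_val. Qed.

(** Renumbering [S] increasingly by [enum_val] respects both the product and [chi_prec], so the
    formula for full index sets applies. *)
Lemma cond_moment theta kappa K n (chi : 'I_n -> bool) (z : 'I_n -> A) (S : {set 'I_n}) :
  cond_cumulants theta kappa K -> S != set0 ->
  theta (zprod z S) = moment (chi_prec chi) (on_blocks kappa chi z) (on_blocks K chi z) S.
Proof.
move=> /cond_cumulantsP H S0.
have -> : zprod z S = \prod_i z (@enum_val _ S i).
  transitivity (\prod_(x <- restr z S) x); first by rewrite big_map.
  rewrite -{1}(imset_enum_val S) restr_enum_val big_map.
  by rewrite -/(zprod _ _) zprodE; apply: eq_bigl => i; rewrite inE.
rewrite -[in RHS](imset_enum_val S) (moment_imset (@enum_val_inj _ S) (@chi_prec_enum_val _ chi S)).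
rewrite (H _ (chi \o enum_val)) ?card_gt0 //.
by apply: eq_moment => V _; rewrite /on_blocks !restr_enum_val.
Qed.

Lemma cond_moment1 theta kappa K n (chi : 'I_n -> bool) (z : 'I_n -> A) i :
  cond_cumulants theta kappa K -> on_blocks K chi z [set i] = theta (z i).
Proof.
move=> H; have S0 : [set i] != set0 by apply/set0Pn; exists i; rewrite set11.
have := cond_moment chi z H S0; rewrite zprodE big_set1 => ->.
by rewrite /moment nc_set1 big_set1 (weight_set1 (chi_irr chi)).
Qed.

Definition shift_at n (z : 'I_n -> A) i (t : C) : 'I_n -> A :=
  fun j => if j == i then z j + t%:A else z j.

Definition shift_invariant n f : Prop :=
  forall (chi : 'I_n -> bool) (z : 'I_n -> A) i t,
    f (args chi) (args (shift_at z i t)) = f (args chi) (args z).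

Lemma prod_shift_at n (z : 'I_n -> A) i t :
  \prod_j shift_at z i t j = \prod_j z j + t *: zprod z (~: [set i]).
Proof.
rewrite zprodE [X in _ *: X](eq_bigl (fun j => j != i)) => [|j]; last by rewrite !inE.
have := index_enum_uniq 'I_n; have : i \in index_enum 'I_n by apply: mem_index_enum.
case/splitPr => s1 s2; rewrite cat_uniq /= => /and3P [_ /norP [i1 _] /andP [i2 _]].
have E (F : 'I_n -> A) s : i \notin s ->
    \prod_(j <- s) shift_at z i t j = \prod_(j <- s) z j.
  move=> iS; apply: eq_big_seq => j js; rewrite /shift_at ifN //.
  by apply: contraNneq iS => <-.
have E2 s : i \notin s -> \prod_(j <- s | j != i) z j = \prod_(j <- s) z j.
  move=> iS; rewrite big_mkcond /=; apply: eq_big_seq => j js; rewrite ifT //.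
  by apply: contraNneq iS => <-.
rewrite !big_cat !big_cons eqxx /= !E ?E2 //.
rewrite /shift_at eqxx mulrDl mulrDr; congr (_ + _).
by rewrite -scalerAl mul1r -scalerAr.
Qed.

Variables phi : A -> C.
Variable kappa : cumulant_family A.
Hypothesis Hkappa : cond_cumulants phi kappa kappa.

Definition unital_linear theta : Prop :=
  [/\ forall a b, theta (a + b) = theta a + theta b,
      forall (c : C) a, theta (c *: a) = c * theta a & theta 1 = 1].

(** If [V] contains [i], its size lies strictly between 1 and [n] and invariance in lower order
    applies; otherwise no argument changes. *)
Lemma on_blocks_shift f n (chi : 'I_n -> bool) (z : 'I_n -> A) i t V :
  (forall m, (1 < m < n)%N -> shift_invariant m f) ->
  V != setT -> V != [set i] ->
  on_blocks f chi (shift_at z i t) V = on_blocks f chi z V.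
Proof.
move=> H VT Vi; case: (boolP (i \in V)) => iV; last first.
  rewrite /on_blocks; congr f; apply/eq_in_map => j; rewrite mem_enum => jV.
  by rewrite /shift_at ifN //; apply: contraNneq iV => <-.
rewrite !on_blocks_enum_val -[RHS](H #|V| _ _ _ (enum_rank_in iV i) t).
  congr (f _ (args _)); apply: functional_extensionality => j.
  rewrite /shift_at /= -(inj_eq enum_val_inj) enum_rankK_in //.
have -> : (#|V| < n)%N = true.
  by rewrite -[X in (_ < X)%N]card_ord -cardsT proper_card // properT.
rewrite andbT ltnNge; apply: contra Vi => V1; rewrite eq_sym eqEcard sub1set iV.
by rewrite cards1.
Qed.

(** By linearity the moment grows by [t] times the moment without the argument [i]. [moment_shift]
    produces the same term, so the cumulant of full order cannot change. *)
Lemma shift_step theta K n : unital_linear phi -> unital_linear theta ->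
  cond_cumulants theta kappa K -> (1 < n)%N ->
  (forall m, (1 < m < n)%N -> shift_invariant m kappa) ->
  (forall m, (1 < m < n)%N -> shift_invariant m K) ->
  shift_invariant n K.
Proof.
move=> Hphi Hth HK n1 IHk IHK chi z i t.
have n0 := ltnW n1; have [thD thZ th1] := Hth.
have /cond_cumulantsP HK' := HK.
have Sx : ~: [set i] != set0.
  apply: contraTneq n1 => S0; rewrite -[n]card_ord -cardsT -(setUCr [set i]) S0.
  by rewrite setU0 cards1.
have one f th : unital_linear th -> cond_cumulants th kappa f ->
    on_blocks f chi (shift_at z i t) [set i] = on_blocks f chi z [set i] + t.
  move=> [D Z o] Hf; rewrite !(cond_moment1 _ _ _ Hf) /shift_at eqxx D Z o.
  by rewrite mulr1.
have := @moment_shift _ _ (chi_irr chi) (@chi_trans _ chi) (@chi_total _ chi) _ i t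
  (on_blocks kappa chi z) (on_blocks K chi z)
  (on_blocks kappa chi (shift_at z i t)) (on_blocks K chi (shift_at z i t)).
rewrite card_ord -!HK' // -(cond_moment chi z HK Sx).
rewrite prod_shift_at thD thZ addrAC subrr add0r => H.
have {}H := H n1 (fun V => @on_blocks_shift _ _ chi z i t V IHk)
  (fun V => @on_blocks_shift _ _ chi z i t V IHK)
  (one _ _ Hphi Hkappa) (one _ _ Hth HK).
apply/eqP; rewrite -subr_eq0; apply/eqP; apply: (addIr (t * theta (zprod z (~: [set i])))).
by rewrite add0r -H.
Qed.

Lemma bf_shift_invariant n : unital_linear phi -> (1 < n)%N -> shift_invariant n kappa.
Proof.
move=> Hphi; elim/ltn_ind: n => n IH n1.
by apply: (shift_step Hphi Hphi Hkappa n1) => m /andP [m1 mn]; apply: IH.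
Qed.

Lemma cond_shift_invariant theta K n : unital_linear phi -> unital_linear theta ->
  cond_cumulants theta kappa K -> (1 < n)%N -> shift_invariant n K.
Proof.
move=> Hphi Hth HK; elim/ltn_ind: n => n IH n1.
apply: (shift_step Hphi Hth HK n1) => m /andP [m1 mn]; last exact: IH.
exact: bf_shift_invariant.
Qed.

(** The arguments are translated one at a time, by induction on the number already translated. *)
Lemma shift_all f n (chi : 'I_n -> bool) (z : 'I_n -> A) (s : 'I_n -> C) :
  shift_invariant n f ->
  f (args chi) (args (fun i => z i + (s i)%:A)) = f (args chi) (args z).
Proof.
move=> H.
pose zX (X : {set 'I_n}) i := if i \in X then z i + (s i)%:A else z i.
suff E X : f (args chi) (args (zX X)) = f (args chi) (args z).
  rewrite -(E setT); congr (f _ (args _)); apply: functional_extensionality => i.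
  by rewrite /zX inE.
move: {2}#|X| (erefl #|X|) => m; elim: m X => [|m IH] X.
  move/eqP; rewrite cards_eq0 => /eqP ->; congr (f _ (args _)).
  by apply: functional_extensionality => i; rewrite /zX inE.
move=> cX; have /card_gt0P [i iX] : (0 < #|X|)%N by rewrite cX.
rewrite -(IH (X :\ i)); last by apply/eqP; rewrite -eqSS -cX (cardsD1 i X) iX.
rewrite -[RHS](H _ _ i (s i)); congr (f _ (args _)); apply: functional_extensionality => j.
by rewrite /zX /shift_at !inE; have [->|] := eqVneq j i; rewrite //= iX.
Qed.

Lemma prod_shift_poly (l : seq A) : exists c : nat -> A,
  [/\ forall i, (size l < i)%N -> c i = 0, c (size l) = 1 &
   forall t : C, \prod_(a <- l) (a + t%:A) = \sum_(i < (size l).+1) t ^+ i *: c i].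
Proof.
elim: l => [|a l [c [c0 c1 cE]]].
  exists (fun i => if i == 0%N then 1 else 0); split=> // [[]//|t].
  by rewrite big_nil big_ord1 expr0 scale1r.
(* The coefficients of the previous polynomial multiplied on the left by [a + t]. *)
exists (fun i => a * c i + (if i is i'.+1 then c i' else 0)); split=> [i li| |t] /=.
- by rewrite c0 ?(ltn_trans _ li) //= mulr0; case: i li => //= i li; rewrite c0 // addr0.
- by rewrite c0 // mulr0 add0r.
rewrite big_cons cE mulrDl.
under [RHS]eq_bigr do rewrite scalerDr.
rewrite big_split /=; congr (_ + _).
  rewrite [RHS]big_ord_recr /= c0 // mulr0 scaler0 addr0 big_distrr.
  by apply: eq_bigr => i _ /=; rewrite -scalerAr.
rewrite [RHS]big_ord_recl scaler0 add0r -scalerAl mul1r scaler_sumr.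
by apply: eq_bigr => i _ /=; rewrite scalerA -exprS.
Qed.

(* The left-hand side is monic in [t], of degree [size l]. *)
Lemma exists_centering theta (l : seq A) : unital_linear theta -> l != [::] ->
  exists t : C, theta (\prod_(a <- l) (a + t%:A)) = 0.
Proof.
move=> [D Z o] l0; have [c [_ c1 cE]] := prod_shift_poly l.
pose p := \poly_(i < (size l).+1) theta (c i).
have sp : size p = (size l).+1 by apply: size_poly_eq; rewrite c1 o oner_neq0.
(* As [l] is not empty, [p] is not constant and has a root in [C]. *)
have [|t /rootP pt] := closed_rootP p _; first by rewrite sp eqSS size_eq0.
exists t; rewrite cE -pt horner_poly.
have th0 : theta 0 = 0 by rewrite -(scale0r 0) Z mul0r.
rewrite (big_morph theta D th0); apply: eq_bigr => i _.
by rewrite Z mulrC.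
Qed.

End Moments.

(** * Families of functionals defined by recursion on the order *)

Section Existence.
Variables (C : numClosedFieldType) (A : algType C).
Variable G : cumulant_family A -> forall n, ('I_n -> bool) -> ('I_n -> A) -> C.
Hypothesis G_local : forall f g n (chi : 'I_n -> bool) (z : 'I_n -> A),
  (forall c l, (size l < n)%N -> f c l = g c l) -> G f chi z = G g chi z.

(** The recursion goes through lengths of lists, so [m] bounds its depth; the value is final once
    [m] exceeds the length of [l]. The defaults of [nth] fill in for a list [c] shorter than [l]. *)
Fixpoint fuel_family (m : nat) : cumulant_family A := fun c l =>
  if m is m'.+1
  then @G (fuel_family m') (size l) (fun i => nth true c i) (fun i => nth 0 l i)
  else 0.

Lemma fuel_family_stable m m' c l : (size l < m)%N -> (size l < m')%N ->
  fuel_family m c l = fuel_family m' c l.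
Proof.
elim: m m' c l => [//|m IH] [//|m'] c l lm lm' /=.
by apply: G_local => c' l' l'l; apply: IH; apply: (leq_trans l'l).
Qed.

Lemma size_restr n T (f : 'I_n -> T) V : size (restr f V) = #|V|.
Proof. by rewrite size_map -cardE. Qed.

Lemma nth_args n T (f : 'I_n -> T) x0 (i : 'I_n) : nth x0 (args f) i = f i.
Proof.
by rewrite /args /restr enum_setT -enumT (nth_map i) ?size_enum_ord // nth_ord_enum.
Qed.

Lemma exists_recursive_family : exists K, forall n (chi : 'I_n -> bool) (z : 'I_n -> A),
  K (args chi) (args z) = G K chi z.
Proof.
exists (fun c l => fuel_family (size l).+1 c l) => n chi z /=.
have E : size (args z) = n by rewrite size_restr cardsT card_ord.
rewrite (@G_local _ (fun c l => fuel_family (size l).+1 c l)); last first.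
  by move=> c l ln; apply: fuel_family_stable.
move: (fun c l => _) (size (args z)) E => f m E; subst m.
by congr G; apply: functional_extensionality => i; rewrite nth_args.
Qed.
End Existence.

(** * Existence of cumulants, and mixed cumulants against factorized moments *)

Section Characterization.
Variables (C : numClosedFieldType) (A : algType C).
Implicit Types (theta : A -> C) (kappa K f : cumulant_family A).

(** [g K] weighs the inner blocks: the identity gives bi-free cumulants, a constant function gives
    conditional ones over a given family. *)
Lemma exists_cond_cumulants theta (g : cumulant_family A -> cumulant_family A) :
  (forall n f f', (forall c l, (size l < n)%N -> f c l = f' c l) ->
     forall c l, (size l < n)%N -> g f c l = g f' c l) ->
  exists K, cond_cumulants theta (g K) K.
Proof.
move=> g_local.
(* The moment formula solved for its one-block term; all other partitions involve lower orders
   only. *)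
pose G f n (chi : 'I_n -> bool) (z : 'I_n -> A) := theta (\prod_(i < n) z i) -
  \sum_(P in nc (chi_prec chi) setT | P != [set setT])
    weight (chi_prec chi) (on_blocks (g f) chi z) (on_blocks f chi z) P.
have [|K HK] := @exists_recursive_family _ _ G.
  move=> f f' n chi z H; congr (_ - _); apply: eq_bigr => P /andP [ncP nP].
  apply: eq_weight => V VP.
  have Vn : (size (restr z V) < n)%N.
    rewrite size_restr -[X in (_ < X)%N]card_ord -cardsT proper_card // properT.
    apply: contraNneq nP => VT; apply/eqP/(nc_setT_block ncP).
    by rewrite -VT.
  by rewrite /on_blocks (g_local _ _ _ H) ?H.
exists K; apply/cond_cumulantsP => n chi z n0.
rewrite /moment (bigD1 [set setT]) ?nc_setT ?card_ord //=.
by rewrite (weight_set1 (chi_irr chi)) [on_blocks K chi z setT]HK subrK.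
Qed.

Variables (I : Type) (Al Ar : I -> A -> Prop).
Hypothesis subl : forall i, unital_subalg (Al i).
Hypothesis subr : forall i, unital_subalg (Ar i).

Lemma asboolP (P : Prop) : reflect P (asbool P).
Proof. by rewrite /asbool; case: excluded_middle_informative => H; constructor. Qed.

(* The first index of the colour of [i] stands for the colour: [I] has no
   decidable equality. *)
Definition colour n (eps : 'I_n -> I) (i : 'I_n) : option 'I_n :=
  [pick j | asbool (eps j = eps i)].

Lemma colourP n (eps : 'I_n -> I) i j :
  reflect (eps i = eps j) (colour eps i == colour eps j).
Proof.
apply: (iffP eqP) => [|e]; last by apply: eq_pick => k; rewrite e.
rewrite /colour; case: pickP => [a /asboolP <-|/(_ i) /asboolP //].
by case: pickP => [b /asboolP <- [->]|//].
Qed.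

Lemma max_mono_intervalP n (chi : 'I_n -> bool) (eps : 'I_n -> I) J :
  max_mono_interval chi eps J <-> J \in max_mono (chi_prec chi) (colour eps).
Proof.
have ivE J' : chi_interval chi J' <-> is_interval (chi_prec chi) J'.
  by split=> [H|/is_intervalP //]; apply/is_intervalP.
have monoE J' : monochromatic eps J' <-> mono (colour eps) J'.
  split=> [H|/monoP H x y xJ yJ]; last by apply/colourP/eqP/H.
  by apply/monoP => x y xJ yJ; apply/eqP/colourP/H.
split=> [[/ivE iJ /monoE mJ H] | /max_monoP [/ivE iJ /monoE mJ H]].
  by apply/max_monoP; split=> // J' /ivE i /monoE m; apply: H.
by split=> // J' /ivE i /monoE m; apply: H.
Qed.

Definition centred phi n (chi : 'I_n -> bool) (eps : 'I_n -> I) (z : 'I_n -> A) : Prop :=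
  forall J, J \in max_mono (chi_prec chi) (colour eps) -> phi (zprod z J) = 0 :> C.

Lemma face_shift i s (a : A) (t : C) : face Al Ar i s a -> face Al Ar i s (a + t%:A).
Proof.
rewrite /face; case: s; [have [u1 ud us _] := subl i | have [u1 ud us _] := subr i];
by move=> ia; apply: ud => //; apply: us.
Qed.

Lemma exists_centred phi n (chi : 'I_n -> bool) (eps : 'I_n -> I) (z : 'I_n -> A) :
  unital_linear phi -> (0 < n)%N ->
  exists s : 'I_n -> C, centred phi chi eps (fun i => z i + (s i)%:A).
Proof.
move=> Hphi n0; set M := max_mono (chi_prec chi) (colour eps).
have /and3P [_ tM M0] : partition M setT.
  by apply: max_mono_partition; rewrite ?card_ord //;
    [apply: chi_irr|apply: chi_trans|apply: chi_total].
(* The membership is a premise inside the existential, so that choice yields a translate for every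
   set. *)
have ex (J : {set 'I_n}) : exists t : C, J \in M -> phi (\prod_(i <- enum J) (z i + t%:A)) = 0.
  case: (boolP (J \in M)) => [JM|_]; last by exists 0.
  have [|t] := exists_centering Hphi (l := [seq z i | i <- enum J]).
    rewrite -size_eq0 size_map -cardE cards_eq0.
    by apply: contraNneq M0 => <-.
  by rewrite big_map; exists t.
pose t J := proj1_sig (constructive_indefinite_description _ (ex J)).
have tP J : J \in M -> phi (\prod_(i <- enum J) (z i + (t J)%:A)) = 0.
  exact: proj2_sig (constructive_indefinite_description _ (ex J)).
(* The intervals are disjoint, so each index receives the translate of its own interval. *)
exists (fun i => t (pblock M i)) => J JM; rewrite -[RHS](tP J JM); congr phi.
apply: eq_big_seq => i; rewrite mem_enum => iJ.
by rewrite (def_pblock tM JM iJ).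
Qed.

Definition mixed_vanish_at n f : Prop :=
  forall (chi : 'I_n -> bool) (eps : 'I_n -> I) (z : 'I_n -> A),
    (forall i, face Al Ar (eps i) (chi i) (z i)) ->
    (exists i j, eps i <> eps j) -> f (args chi) (args z) = 0.

Lemma on_blocks_mixed f n (chi : 'I_n -> bool) (eps : 'I_n -> I) (z : 'I_n -> A)
    (V : {set 'I_n}) : mixed_vanish_at #|V| f -> (forall i, face Al Ar (eps i) (chi i) (z i)) ->
  ~~ mono (colour eps) V -> on_blocks f chi z V = 0.
Proof.
move=> H fz /forall_inPn [i iV /forall_inPn [j jV ne]]; rewrite on_blocks_enum_val.
apply: (H _ (eps \o @enum_val _ V)) => [k|]; first exact: fz.
exists (enum_rank_in iV i), (enum_rank_in iV j); rewrite /= !enum_rankK_in //.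
by apply/colourP.
Qed.

(** [k0] and [K0] are the cumulants with mixed blocks set to zero. Keeping them apart from [kappa]
    and [K] makes the lemma usable before the mixed cumulants are known to vanish. Inside a maximal
    interval all blocks are monochromatic, so its moments are the actual ones. *)
Lemma cond_moment_mono theta phi kappa K n (chi : 'I_n -> bool)
    (eps : 'I_n -> I) (z : 'I_n -> A) (k0 K0 : {set 'I_n} -> C) :
  cond_cumulants phi kappa kappa -> cond_cumulants theta kappa K -> (0 < n)%N ->
  centred phi chi eps z ->
  (forall V, mono (colour eps) V -> k0 V = on_blocks kappa chi z V) ->
  (forall V, mono (colour eps) V -> K0 V = on_blocks K chi z V) ->
  (forall V, ~~ mono (colour eps) V -> k0 V = 0) ->
  (forall V, ~~ mono (colour eps) V -> K0 V = 0) ->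
  moment (chi_prec chi) k0 K0 setT =
  \prod_(J in max_mono (chi_prec chi) (colour eps)) theta (zprod z J).
Proof.
move=> Hk HK n0 cz k0m K0m k00 K00.
have T0 : (0 < #|'I_n|)%N by rewrite card_ord.
set M := max_mono (chi_prec chi) (colour eps).
have /and3P [_ _ M0] : partition M setT.
  by apply: max_mono_partition; rewrite ?card_ord //;
    [apply: chi_irr|apply: chi_trans|apply: chi_total].
have Jn0 J : J \in M -> J != set0 by move=> JM; apply: contraNneq M0 => <-.
have sub J (V : {set 'I_n}) : J \in M -> V \subset J -> mono (colour eps) V.
  move=> /max_monoP [_ /monoP mJ _] /subsetP VJ; apply/monoP => x y xV yV.
  by apply: mJ; apply: VJ.
rewrite (moment_max_mono (chi_irr chi) (@chi_trans _ chi) (@chi_total _ chi) T0 k00 K00).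
  apply: eq_bigr => J JM; rewrite (cond_moment chi z HK (Jn0 _ JM)).
  by apply: eq_moment => V VJ; rewrite k0m ?K0m ?(sub J).
move=> J JM; rewrite -(cz _ JM) (cond_moment chi z Hk (Jn0 _ JM)).
by apply: eq_moment => V VJ; rewrite k0m ?(sub J).
Qed.

Lemma vanish_step theta phi kappa K n : unital_linear phi -> unital_linear theta ->
  cond_cumulants phi kappa kappa -> cond_cumulants theta kappa K ->
  (forall (chi : 'I_n -> bool) (eps : 'I_n -> I) (z : 'I_n -> A), (0 < n)%N ->
    (forall i, face Al Ar (eps i) (chi i) (z i)) -> centred phi chi eps z ->
    theta (\prod_(i < n) z i) =
    \prod_(J in max_mono (chi_prec chi) (colour eps)) theta (zprod z J)) ->
  (forall m, (m < n)%N -> mixed_vanish_at m kappa) ->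
  (forall m, (m < n)%N -> mixed_vanish_at m K) ->
  mixed_vanish_at n K.
Proof.
move=> Hphi Hth Hk HK HM IHk IHK chi eps z fz [i [j ij]].
have n1 : (1 < n)%N.
  rewrite -[n]card_ord; apply/card_gt1P; exists i, j; split=> //.
  by apply/eqP => e; apply: ij; rewrite e.
have n0 := ltnW n1.
(* The order is at least two, so translation leaves the cumulant unchanged, while the translated
   arguments stay in their faces. *)
have [s cz] := exists_centred chi eps z Hphi n0.
rewrite -(shift_all chi z s (cond_shift_invariant Hk Hphi Hth HK n1)).
move: cz; set z' := (fun i => _) => cz.
have fz' k : face Al Ar (eps k) (chi k) (z' k) by apply: face_shift.
(* By induction [cut] can change the weights on the full set only. Actual and cut weights have the
   same moment, so the full mixed cumulant is zero. *)
pose cut (F : {set 'I_n} -> C) V := if mono (colour eps) V then F V else 0.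
have nT : mono (colour eps) [set: 'I_n] = false.
  by apply/negP => /monoP /(_ i j (in_setT _) (in_setT _)) /eqP /colourP.
have cutE f V : (forall m, (m < n)%N -> mixed_vanish_at m f) -> V != setT ->
    on_blocks f chi z' V = cut (on_blocks f chi z') V.
  move=> IH VT; rewrite /cut; case: ifP => // /negbT nV.
  apply: (on_blocks_mixed (IH _ _) fz' nV).
  by rewrite -[X in (_ < X)%N]card_ord -cardsT proper_card // properT.
have /cond_cumulantsP /(_ n chi z' n0) E := HK.
have T0 : (0 < #|'I_n|)%N by rewrite card_ord.
have := moment_setT_sub (chi_irr chi) T0 (fun V => cutE kappa V IHk) (fun V => cutE K V IHK).
rewrite -E (HM chi eps) // (@cond_moment_mono theta phi kappa K n chi eps z') //; first last.
- by move=> V; rewrite /cut => /negPf ->.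
- by move=> V; rewrite /cut => /negPf ->.
- by move=> V; rewrite /cut => ->.
- by move=> V; rewrite /cut => ->.
by rewrite subrr /cut nT subr0 => /esym.
Qed.

Lemma cond_moment_of_vanish theta phi kappa K n (chi : 'I_n -> bool) (eps : 'I_n -> I)
    (z : 'I_n -> A) :
  cond_cumulants phi kappa kappa -> cond_cumulants theta kappa K ->
  mixed_vanish Al Ar kappa -> mixed_vanish Al Ar K -> (0 < n)%N ->
  (forall i, face Al Ar (eps i) (chi i) (z i)) -> centred phi chi eps z ->
  theta (\prod_(i < n) z i) =
  \prod_(J in max_mono (chi_prec chi) (colour eps)) theta (zprod z J).
Proof.
move=> Hk HK vk vK n0 fz cz; have /cond_cumulantsP E := HK; rewrite (E n chi) //.
apply: (cond_moment_mono Hk HK n0 cz) => // V nV.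
- exact: (on_blocks_mixed (@vk _) fz nV).
- exact: (on_blocks_mixed (@vK _) fz nV).
Qed.

(** With at least one index there is at least one factor. Hence the condition that [phi] vanishes is
    the product formula with [phi] in place of [theta]. *)
Lemma centred_prod0 phi n (chi : 'I_n -> bool) (eps : 'I_n -> I) (z : 'I_n -> A) :
  (0 < n)%N -> centred phi chi eps z ->
  \prod_(J in max_mono (chi_prec chi) (colour eps)) phi (zprod z J) = 0.
Proof.
move=> n0 cz.
have [J JM _] := max_mono_cover (chi_irr chi) (@chi_trans _ chi) (colour eps) (Ordinal n0).
by rewrite (bigD1 J) //= cz // mul0r.
Qed.
End Characterization.

Theorem theorem8 (C : numClosedFieldType) (A : algType C) (star : A -> A)
    (phi theta : A -> C) (I : Type) (Al Ar : I -> A -> Prop) :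
  is_star star -> is_state star phi -> is_state star theta ->
  (forall i, unital_subalg (Al i)) -> (forall i, unital_subalg (Ar i)) ->
  cond_bifree Al Ar phi theta <-> vanishing_characterization Al Ar phi theta.
Proof.
move=> _ [phiD phiZ phi1 _] [thD thZ th1 _] subl subr.
have Hphi : unital_linear phi by split.
have Hth : unital_linear theta by split.
have prodE n (chi : 'I_n -> bool) (eps : 'I_n -> I) (F : {set 'I_n} -> C) :
    \prod_(J : {set 'I_n} | asbool (max_mono_interval chi eps J)) F J =
    \prod_(J in max_mono (chi_prec chi) (colour eps)) F J.
  by apply: eq_bigl => J; apply/asboolP/idP => /max_mono_intervalP.
have centredE n (chi : 'I_n -> bool) (eps : 'I_n -> I) (z : 'I_n -> A) :
    centred phi chi eps z <->
    (forall J, max_mono_interval chi eps J -> phi (zprod z J) = 0).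
  by split=> H J /max_mono_intervalP; apply: H.
split=> [H n chi eps z n0 fz /centredE cz | H kappa K /bf_cumulantsP Hk HK].
  (* [cond_bifree] speaks of all families satisfying the moment formulas, so it gives information
     only once such families exist. *)
  have [kappa Hk] := @exists_cond_cumulants _ _ phi id (fun _ _ _ h => h).
  have [K HK] := @exists_cond_cumulants _ _ theta (fun=> kappa) (fun _ _ _ _ _ _ _ => erefl).
  have [vk vK] := H kappa K (proj2 (bf_cumulantsP _ _) Hk) HK.
  rewrite prodE -(cond_moment_of_vanish Hk HK vk vK) //; split=> //.
  by rewrite (cond_moment_of_vanish Hk Hk vk vk n0 fz cz) centred_prod0.
have Mphi n (chi : 'I_n -> bool) (eps : 'I_n -> I) (z : 'I_n -> A) : (0 < n)%N ->
    (forall i, face Al Ar (eps i) (chi i) (z i)) -> centred phi chi eps z ->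
    phi (\prod_(i < n) z i) =
    \prod_(J in max_mono (chi_prec chi) (colour eps)) phi (zprod z J).
  by move=> n0 fz cz; rewrite centred_prod0 //;
    case: (H n chi eps z n0 fz (proj1 (centredE _ _ _ _) cz)).
have Mth n (chi : 'I_n -> bool) (eps : 'I_n -> I) (z : 'I_n -> A) : (0 < n)%N ->
    (forall i, face Al Ar (eps i) (chi i) (z i)) -> centred phi chi eps z ->
    theta (\prod_(i < n) z i) =
    \prod_(J in max_mono (chi_prec chi) (colour eps)) theta (zprod z J).
  by move=> n0 fz cz; rewrite -prodE; case: (H n chi eps z n0 fz (proj1 (centredE _ _ _ _) cz)).
(* [kappa] comes first, since the induction for [K] also uses that its mixed values vanish. *)
have vk n : mixed_vanish_at Al Ar n kappa.
  elim/ltn_ind: n => n IH.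
  exact: (vanish_step subl subr Hphi Hphi Hk Hk (@Mphi n) IH IH).
have vK n : mixed_vanish_at Al Ar n K.
  elim/ltn_ind: n => n IH.
  exact: (vanish_step subl subr Hphi Hth Hk HK (@Mth n) (fun m _ => vk m) IH).
by split=> n; [apply: vk|apply: vK].
Qed.
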